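(* Let $B\subseteq(N_0\times N_1)\cup(N_1\times N_0)$ be an $F_\sigma$ Acyclic oriented graph on $2^\omega$ such that $\mathbb{B}_0=\overline{\mathbb{B}_0}\cap B$. Assume that for all $\varepsilon\in2$ and $\alpha,\beta\in2^\omega$, $(\varepsilon\alpha,(1-\varepsilon)\beta)\in B\iff(\varepsilon\beta,(1-\varepsilon)\alpha)\in B$. Then $(2^\omega,G_{s(\mathbb{G}_0)})\sqsubseteq_c(2^\omega,B)$.
   Context: $N_s:=\{\alpha\in2^\omega\mid s\subseteq\alpha\}$; $\overline{E}$ closure; $s(E):=E\cup E^{-1}$. Oriented graph = irreflexive relation $E$ with $E\cap E^{-1}$ contained in the diagonal; Acyclic means $s(E)$ has no injective sequence $(x_i)_{i\le n}$, $n\ge2$, with $(x_i,x_{i+1})\in s(E)$ for $i<n$ and $(x_n,x_0)\in s(E)$. $(X,A)\sqsubseteq_c(Y,C)$ means there is an injective continuous $f:X\to Y$ with $(f(x),f(y))\in C\iff(x,y)\in A$. Let $\psi:\omega\to2^{<\omega}$ list finite binary sequences by increasing length and lexicographically within each length, $s_n:=\psi(n)0^{n-|\psi(n)|}$, $\mathbb{G}_0:=\{(s_n0\gamma,s_n1\gamma)\mid n\in\omega,\gamma\in2^\omega\}$, $\mathbb{B}_0:=\{(0\alpha,1\beta)\mid(\alpha,\beta)\in\mathbb{G}_0\}$, $G_{s(\mathbb{G}_0)}:=\{(0\alpha,1\beta)\mid(\alpha,\beta)\in s(\mathbb{G}_0)\}$. *)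

(* Defs.v *)
From mathcomp Require Import all_boot.
From mathcomp Require Import classical_sets topology cantor borel_hierarchy.

Set Implicit Arguments.
Unset Strict Implicit.
Unset Printing Implicit Defensive.

Local Open Scope classical_set_scope.
Local Open Scope nat_scope.

(* Binary relations on T are subsets of T * T, so that [closure] and [Fsigma]
   refer to the product topology.  The space 2^omega is [cantor_space], with
   0 and 1 encoded as [false] and [true]. *)

Section relations.
Variable T : Type.
Implicit Type E : set (T * T).

Definition rel_inv E : set (T * T) := [set p | E (p.2, p.1)].

Definition symm E : set (T * T) := E `|` rel_inv E.

Definition oriented_graph E : Prop :=
  (forall x, ~ E (x, x)) /\ E `&` rel_inv E `<=` [set p | p.1 = p.2].

(* A finite sequence (x_i)_{i <= n} is given by a function on nat of which only
   the values at 0, ..., n matter. *)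
Definition Acyclic E : Prop :=
  ~ exists n (x : nat -> T),
      [/\ 2 <= n,
          forall i j, i <= n -> j <= n -> x i = x j -> i = j,
          forall i, i < n -> symm E (x i, x i.+1)
        & symm E (x n, x 0)].

End relations.

Definition cont_reduces (X Y : topologicalType)
    (A : set (X * X)) (C : set (Y * Y)) : Prop :=
  exists f : X -> Y,
    [/\ injective f, continuous f
      & forall x y, C (f x, f y) <-> A (x, y)].

Definition scat (s : seq bool) (a : cantor_space) : cantor_space :=
  fun i => if i < size s then nth false s i else a (i - size s).

Definition scons (e : bool) (a : cantor_space) : cantor_space :=
  scat [:: e] a.

Definition N_ (s : seq bool) : set cantor_space :=
  [set a | forall i, i < size s -> a i = nth false s i].

(* The binary words of length k, in lexicographic order. *)
Fixpoint binwords (k : nat) : seq (seq bool) :=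
  if k is k'.+1 then
    map (cons false) (binwords k') ++ map (cons true) (binwords k')
  else [:: [::]].

(* There are at least n + 1 words of length at most n, so the default value of
   [nth] is never used. *)
Definition psi (n : nat) : seq bool :=
  nth [::] (flatten (mkseq binwords n.+1)) n.

Definition s_ (n : nat) : seq bool := psi n ++ nseq (n - size (psi n)) false.

Definition G0 : set (cantor_space * cantor_space) :=
  [set p | exists n (c : cantor_space),
     p = (scat (rcons (s_ n) false) c, scat (rcons (s_ n) true) c)].

Definition bip (A : set (cantor_space * cantor_space)) :
    set (cantor_space * cantor_space) :=
  [set (scons false p.1, scons true p.2) | p in A].

Definition B0 : set (cantor_space * cantor_space) := bip G0.

Definition G_sG0 : set (cantor_space * cantor_space) := bip (symm G0).

(* Main.v *)
(* Write [cross a b] for: [0a] and [1b] are adjacent in [s(B)].  By the swap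
   hypothesis this is symmetric, and it contains [s(G0)], whose restriction to
   the words of a given length is connected.  Two words [x], [y] of the same
   length (possibly equal) that are not [s(G0)]-adjacent have a common
   continuation [c] with [~ cross (xc) (yc)]: otherwise the edges
   [0xc -- 1yc], together with a path from [y] to [x], give a cycle of [s(B)].
   Since [B] is a countable union of closed sets [F i], one can choose words
   [t_0, t_1, ...] such that the map [h a = t_0 a_0 t_1 a_1 ...] sends [G0] into
   [G0] and, for each [i], maps pairs outside [s(G0)] to pairs that are not
   joined through [F i].  Then [e a |-> e (h a)] is the required reduction, the
   pairs in [N_1 x N_0] being excluded because [B] is oriented. *)

Require Import Defs.
From mathcomp Require Import all_boot.
From mathcomp Require Import mathcomp_extra boolp classical_sets topology.
From mathcomp Require Import function_spaces cantor borel_hierarchy.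

Set Implicit Arguments.
Unset Strict Implicit.
Unset Printing Implicit Defensive.

Local Open Scope classical_set_scope.
Local Open Scope nat_scope.

(** * Cylinders as a neighbourhood basis of the Cantor space *)

Definition cylinder (a : cantor_space) n : set cantor_space :=
  [set b | forall i, i < n -> b i = a i].

Lemma cylinder_nbhs a n : nbhs a (cylinder a n).
Proof.
elim: n => [|n IHn]; first exact: (filterS _ filterT).
have nbhsn : nbhs a (proj n @^-1` [set a n] : set cantor_space).
  exact: (@proj_continuous _ (fun=> bool) n a) (discrete_set1 _).
apply: filterS (filterI IHn nbhsn) => b [bE bn] i.
by rewrite ltnS leq_eqVlt => /predU1P[->|/bE].
Qed.

(** The filter generated by the cylinders at [a] converges to [a], since convergence in a product is
    tested on one coordinate at a time. *)
Lemma nbhs_cylinder (a : cantor_space) U :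
  nbhs a U -> exists n, cylinder a n `<=` U.
Proof.
pose F := filter_from [set: nat] (cylinder a).
have FF : Filter F.
  apply: filter_from_filter => [|m n _ _]; first by exists 0.
  exists (maxn m n) => // b bE.
  by split=> i ilt; apply: bE; rewrite leq_max ilt ?orbT.
have cvgF : F --> a.
  apply/cvg_sup => i A; rewrite nbhsE => -[_ [[O oO <-] Oa] OA].
  by exists i.+1 => // b bE; apply: OA; rewrite /= bE.
by move=> /cvgF[n _ nU]; exists n.
Qed.

Lemma open_cylinders (U : set (cantor_space * cantor_space)) a b :
  open U -> U (a, b) ->
  exists n, forall c d, cylinder a n c -> cylinder b n d -> U (c, d).
Proof.
move=> oU Uab; have [[P Q] /= [nP nQ] PQU] := open_nbhs_nbhs (conj oU Uab).
have [m mP] := nbhs_cylinder nP; have [n nQ'] := nbhs_cylinder nQ.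
exists (maxn m n) => c d cc cd; apply: PQU; split=> /=.
  by apply: mP => i im; apply: cc; rewrite leq_max im.
by apply: nQ' => i im; apply: cd; rewrite leq_max im orbT.
Qed.

Lemma continuous_cantor (f : cantor_space -> cantor_space) :
  (forall a n, exists m, forall b, cylinder a m b -> f b n = f a n) ->
  continuous f.
Proof.
move=> fP a U /nbhs_cylinder[n nU].
have [m mP] : exists m, forall b, cylinder a m b -> cylinder (f a) n (f b).
  elim: n {U nU} => [|n [m mP]]; first by exists 0.
  have [k kP] := fP a n; exists (maxn m k) => b ab i.
  rewrite ltnS leq_eqVlt => /predU1P[->|ilt].
    by apply: kP => j jk; apply: ab; rewrite leq_max jk orbT.
  by apply: mP => // j jm; apply: ab; rewrite leq_max jm.
by apply: filterS (cylinder_nbhs a m) => b /mP /nU.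
Qed.

(** * Concatenation of words and points *)

Lemma scat_nth s c i :
  scat s c i = if i < size s then nth false s i else c (i - size s).
Proof. by []. Qed.

Lemma scat_cat s t c : scat (s ++ t) c = scat s (scat t c).
Proof.
apply: funext => i; rewrite !scat_nth size_cat nth_cat.
have [si|si] := ltnP i (size s); first by rewrite ltn_addr.
by rewrite -subnDA ltn_subLR.
Qed.

Lemma scat_inj s t c d : size s = size t ->
  scat s c = scat t d -> s = t /\ c = d.
Proof.
move=> st e; split.
  apply: (@eq_from_nth _ false) => // i si; move/(congr1 (@^~ i)): e.
  by rewrite /= !scat_nth -st si.
apply: funext => i; move/(congr1 (@^~ (size s + i))): e.
by rewrite /= !scat_nth -st ltnNge leq_addr /= addKn.
Qed.

Lemma scons_inj a b c d : scons a c = scons b d -> a = b /\ c = d.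
Proof. by case/scat_inj => // -[]. Qed.

Lemma sconsS e a i : scons e a i.+1 = a i.
Proof. by rewrite /scons scat_nth /= subSS subn0. Qed.

Lemma scons_eta a : a = scons (a 0) (fun i => a i.+1).
Proof. by apply: funext => -[|i] //; rewrite sconsS. Qed.

Lemma scat_take a n : a = scat (mkseq a n) (fun i => a (n + i)).
Proof.
apply: funext => i; rewrite scat_nth size_mkseq.
by case: ltnP => ni; rewrite ?nth_mkseq ?subnKC.
Qed.

(** * The enumeration [psi] and the density of the words [s_ n] *)

Lemma mem_binwords k s : (s \in binwords k) = (size s == k).
Proof.
elim: k s => [|k IHk] [|b s] //=; rewrite mem_cat.
  by apply/norP; split; apply/mapP => -[].
have mem_cons b' l : (b :: s \in map (cons b') l) = (b == b') && (s \in l).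
  apply/mapP/andP => [[u ul [-> ->]]|[/eqP-> sl]]; first by rewrite eqxx.
  by exists s.
by rewrite !mem_cons IHk eqSS; case: b {mem_cons}; rewrite ?orbF.
Qed.

Lemma binwords_gt0 k : 0 < size (binwords k).
Proof. by elim: k => //= k IHk; rewrite size_cat !size_map ltn_addr. Qed.

Local Notation words n := (flatten (mkseq binwords n)).

Lemma words_cat m n : m <= n -> exists w, words n = words m ++ w.
Proof.
move=> /subnKC <-; elim: (n - m) => [|k [w IHk]].
  by exists [::]; rewrite addn0 cats0.
exists (w ++ binwords (m + k)); rewrite addnS /mkseq -addn1 iotaD map_cat.
by rewrite flatten_cat /= cats0 [flatten _]IHk catA.
Qed.

Lemma size_words n : n <= size (words n).
Proof.
elim: n => // n IHn; rewrite /mkseq -addn1 iotaD map_cat flatten_cat size_cat.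
by apply: leq_add => //=; rewrite cats0 binwords_gt0.
Qed.

(** The lists of words of bounded length extend one another, so the bound built into [psi i] can be
    traded for any bound that reaches the index. *)
Lemma nth_words n i : i < size (words n) -> nth [::] (words n) i = psi i.
Proof.
move=> ilt; rewrite /psi; have := size_words i.+1.
have [/words_cat[w ->]|/ltnW/words_cat[w wE]] := leqP i.+1 n.
  by move=> ii; rewrite nth_cat ii.
by move: ilt; rewrite wE => ilt _; rewrite nth_cat ilt.
Qed.

Lemma psi_surj s : exists n, psi n = s.
Proof.
have sP : s \in words (size s).+1.
  apply/flattenP; exists (binwords (size s)); last by rewrite mem_binwords.
  by apply/mapP; exists (size s); rewrite // mem_iota ltnSn.
exists (index s (words (size s).+1)).
by rewrite -(@nth_words (size s).+1) ?index_mem ?nth_index.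
Qed.

Lemma size_psi n : size (psi n) <= n.
Proof.
have /flattenP[_ /mapP[k kn ->]] : psi n \in words n.+1.
  by rewrite mem_nth // size_words.
by rewrite mem_binwords => /eqP ->; move: kn; rewrite mem_iota.
Qed.

Lemma size_s_ n : size (s_ n) = n.
Proof. by rewrite size_cat size_nseq subnKC // size_psi. Qed.

Lemma s_dense s : exists r n, s ++ r = s_ n.
Proof.
have [n nE] := psi_surj s.
by exists (nseq (n - size s) false), n; rewrite /s_ nE.
Qed.

(** * The finite traces of [s(G0)] on words of equal length *)

Definition adj (x y : seq bool) : Prop :=
  exists m b w, x = s_ m ++ b :: w /\ y = s_ m ++ ~~ b :: w.

Lemma adj_sym x y : adj x y -> adj y x.
Proof. by move=> [m [b [w [-> ->]]]]; exists m, (~~ b), w; rewrite negbK. Qed.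

Lemma adj_size x y : adj x y -> size x = size y.
Proof. by move=> [m [b [w [-> ->]]]]; rewrite !size_cat. Qed.

Lemma adj_irrefl x : ~ adj x x.
Proof.
move=> [m [b [w [-> /eqP]]]].
by rewrite eqseq_cat // eqxx /= => /eqP -[]; case: b.
Qed.

Lemma adj_cat w x y : adj x y -> adj (x ++ w) (y ++ w).
Proof.
move=> [m [b [v [-> ->]]]]; exists m, b, (v ++ w).
by rewrite -!catA.
Qed.

(** Adjacent words differ in a single place. If it lay in the common suffix [w], then [x] and [y]
    would coincide, against irreflexivity. *)
Lemma adj_catK w x y : size x = size y -> adj (x ++ w) (y ++ w) -> adj x y.
Proof.
move=> xy xyw; have [m [b [v [xE yE]]]] := xyw.
have xT : x = take (size x) (s_ m ++ b :: v) by rewrite -xE take_size_cat.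
have yT : y = take (size x) (s_ m ++ ~~ b :: v) by rewrite -yE xy take_size_cat.
move: xT yT; rewrite !take_cat; case: ltnP => [_ xT yT|].
  by move: xyw; rewrite xT -yT => /adj_irrefl.
case: (size x - _) => [_|k _ xT yT]; last by exists m, b, (take k v).
by rewrite !cats0 => xT yT; move: xyw; rewrite xT -yT => /adj_irrefl.
Qed.

Definition adjb x y := `[< adj x y >].

(** Induction on the length: prefixes are moved along lifted paths, and the last letter is changed
    along the edge between [s_n 0] and [s_n 1]. *)
Lemma adj_connected x y : size x = size y ->
  exists2 p, path adjb x p & last x p = y.
Proof.
have trans u v w : (exists2 p, path adjb u p & last u p = v) ->
    (exists2 p, path adjb v p & last v p = w) ->
    exists2 p, path adjb u p & last u p = w.
  move=> [p up <-] [q vq <-]; exists (p ++ q); last by rewrite last_cat.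
  by rewrite cat_path up.
have lift u v c : (exists2 p, path adjb u p & last u p = v) ->
    exists2 p, path adjb (rcons u c) p & last (rcons u c) p = rcons v c.
  move=> [p up <-].
  exists (map (rcons^~ c) p); last exact: (last_map (rcons^~ c)).
  apply: (homo_path (f := rcons^~ c)) up => s t /asboolP st.
  by apply/asboolP; rewrite -!cats1; apply: adj_cat.
have [n xn] : exists n, size x = n by exists (size x).
rewrite xn; elim: n x y xn => [|n IHn] x y.
  by move=> /size0nil-> /esym/size0nil->; exists [::].
case/lastP: x => // x a; case/lastP: y => // y b.
rewrite !size_rcons => -[xn] [yn].
have [<-|ab] := eqVneq a b; first exact/lift/IHn.
apply: (trans _ (rcons (s_ n) a)); first by apply/lift/IHn; rewrite ?size_s_.
apply: (trans _ (rcons (s_ n) b)); last by apply/lift/IHn; rewrite ?size_s_.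
exists [:: rcons (s_ n) b] => //=; rewrite andbT; apply/asboolP.
by exists n, a, [::]; rewrite -!cats1; case: a b ab => [] [].
Qed.

Lemma adj_uniq_path x y : size x = size y ->
  exists2 p, path adjb x p & last x p = y /\ uniq (x :: p).
Proof.
by move=> /adj_connected[p xp <-]; case/shortenP: xp => q xq uq _; exists q.
Qed.

Lemma adj_path_size x p :
  path adjb x p -> {in x :: p, forall z, size z = size x}.
Proof.
elim: p x => [x _|y p IHp x /= /andP[/asboolP/adj_size xy /IHp yp]] z.
  by rewrite inE => /eqP->.
by rewrite inE => /predU1P[->//|/yp ->].
Qed.

(** * Lifts of paths of words to the bipartite double cover *)

Fixpoint alternate (e : bool) (q : seq (seq bool)) : seq (bool * seq bool) :=
  if q is x :: q' then (e, x) :: alternate (~~ e) q' else [::].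

Lemma mem_alternate e q u : u \in alternate e q -> u.2 \in q.
Proof.
elim: q e => //= x q IHq e; rewrite !inE => /predU1P[->|/IHq ->].
  by rewrite eqxx.
exact: orbT.
Qed.

Lemma uniq_alternate e q : uniq q -> uniq (alternate e q).
Proof.
elim: q e => //= x q IHq e /andP[xq /IHq ->]; rewrite andbT.
by apply: contra xq => /mem_alternate.
Qed.

Lemma size_alternate e q : size (alternate e q) = size q.
Proof. by elim: q e => //= x q IHq e; rewrite IHq. Qed.

Lemma last_alternate e x p :
  last (e, x) (alternate (~~ e) p) = (e (+) odd (size p), last x p).
Proof.
elim: p e x => [|y p IHp] e x /=; first by rewrite addbF.
by rewrite IHp addNb addbN.
Qed.

(** The last word of a duplicate-free path occurs only at its end, so the lift meets it on one side
    only, fixed by the parity of the length. *)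
Lemma alternate_last_parity b e x p : uniq (x :: p) ->
  (b, last x p) \in alternate e (x :: p) -> b = e (+) odd (size p).
Proof.
elim: p e x => [|y p IHp] e x.
  by move=> _; rewrite inE => /eqP[->]; rewrite addbF.
rewrite [uniq _]/= => /andP[xyp uyp]; rewrite /= -[_ :: _]/([:: (e, x)] ++ _).
rewrite inE => /predU1P[[_ xE]|/(IHp (~~ e) y uyp) ->].
  by move: xyp; rewrite -xE mem_last.
by rewrite addNb addbN.
Qed.

(** * Cycles of [s(B)] built from paths of words *)

Lemma Acyclic_cycle (T : eqType) (E : set (T * T)) (c : seq T) :
  Acyclic E -> 2 < size c -> uniq c ->
  cycle (fun x y => `[< symm E (x, y) >]) c -> False.
Proof.
case: c => // x c acE c2 uc xc; apply: acE.
(* After the case analysis [c] is the tail of the cycle, so [size c] is the index of the last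
   vertex. *)
exists (size c), (nth x (x :: c)); split=> //.
- by move=> i j ic jc /eqP; rewrite nth_uniq // => /eqP.
- move=> i ic; move/(pathP x)/(_ i): xc; rewrite size_rcons.
  move=> /(_ (ltnW ic))/asboolP.
  by rewrite -rcons_cons !nth_rcons /= ic ltnS ltnW.
- by move: xc; rewrite /= rcons_path => /andP[_ /asboolP]; rewrite nth_last.
Qed.

Definition cross (B : set (cantor_space * cantor_space)) a b :=
  symm B (scons false a, scons true b).

Definition vertex c (u : bool * seq bool) := scons u.1 (scat u.2 c).

Lemma vertex_inj c d u v : size u.2 = size v.2 ->
  vertex c u = vertex d v -> u = v /\ c = d.
Proof.
by case: u v => [? ?] [? ?] /= uv /scons_inj[/= -> /(scat_inj uv)[/= -> ->]].
Qed.

Lemma cycle_cat2 (T : Type) (e : rel T) x p y q :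
  cycle e ((x :: p) ++ (y :: q)) =
  [&& path e x p, e (last x p) y, path e y q & e (last y q) x].
Proof. by rewrite /= rcons_path cat_path last_cat /= !andbA. Qed.

Section Crossing.
Variable B : set (cantor_space * cantor_space).
Hypothesis B_swap : forall e a b,
  B (scons e a, scons (~~ e) b) <-> B (scons e b, scons (~~ e) a).
Hypothesis B0B : B0 `<=` B.
Hypothesis acB : Acyclic B.

Lemma cross_sym a b : cross B a b -> cross B b a.
Proof.
by case=> /= [/(B_swap false)|/(B_swap true)] Bab; [left|right].
Qed.

Lemma symm_cross e a b : cross B a b -> symm B (scons e a, scons (~~ e) b).
Proof.
case: e => // /cross_sym.
by rewrite /cross /symm /rel_inv /= => -[]; [right|left].
Qed.

Lemma G0_cross a b : G0 (a, b) -> B (scons false a, scons true b).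
Proof. by move=> ab; apply: B0B; exists (a, b). Qed.

Lemma adj_cross x y c : adj x y -> cross B (scat x c) (scat y c).
Proof.
move=> [m [b [w [-> ->]]]].
wlog bF : b / b = false => [hyp|].
  case: b; last exact: hyp.
  by apply: cross_sym; apply: hyp.
rewrite bF; left; apply: G0_cross; exists m, (scat w c).
by rewrite -!scat_cat -!cats1 -!catA.
Qed.

Let symmb x y := `[< symm B (x, y) >].

(** Adjacent words cross under any common continuation, so a path of words lifts to a path of [s(B)]
    that switches sides at each step. *)
Lemma path_vertex c e x p : path adjb x p ->
  path symmb (vertex c (e, x)) (map (vertex c) (alternate (~~ e) p)).
Proof.
elim: p e x => //= y p IHp e x /andP[/asboolP xy yp].
rewrite IHp // andbT; apply/asboolP/symm_cross; exact: adj_cross.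
Qed.

Lemma uniq_vertex c n s : {in s, forall u, size u.2 = n} ->
  uniq (map (vertex c) s) = uniq s.
Proof.
move=> sn; rewrite map_inj_in_uniq // => u v us vs.
by case/vertex_inj => //; rewrite !sn.
Qed.

Lemma nonadj_not_cross x y : size x = size y -> ~ adj x y ->
  exists c, ~ cross B (scat x c) (scat y c).
Proof.
(* For contradiction, [x] and [y] cross under every continuation; the even case below uses two of
   them. *)
move=> xy nadj; apply: contrapT => /forallNP all_cross.
have xyS c : cross B (scat x c) (scat y c) by apply: contrapT; apply: all_cross.
have [p yp [lyp uyp]] := adj_uniq_path (esym xy).
have szyp := adj_path_size yp.
have szalt e : {in alternate e (y :: p), forall u, size u.2 = size y}.
  by move=> u /mem_alternate/szyp.
have path_yp c := path_vertex c true yp.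
have last_yp := last_alternate true y p.
have ualt : uniq (alternate true (y :: p)) by apply: uniq_alternate.
have edge c : symmb (vertex c (false, x)) (vertex c (true, y)).
  by apply/asboolP/(symm_cross false).
(* A path of odd length links [1yc] to [0xc] and is closed by the edge above. *)
have [odd_p|even_p] := boolP (odd (size p)).
  pose c : cantor_space := fun=> false.
  apply: (Acyclic_cycle (c := map (vertex c) (alternate true (y :: p))) acB).
  (* A path of length 1 would be an edge between [y] and [x], so an odd path has length at least
     3. *)
  - rewrite size_map size_alternate /=.
    case: p odd_p yp lyp {uyp szyp szalt path_yp last_yp ualt}
      => [|z [|? []]] //= _.
    by rewrite andbT => /asboolP yz zx; case: nadj; apply: adj_sym; rewrite -zx.
  - by rewrite (uniq_vertex _ (szalt true)).
  - rewrite /= rcons_path path_yp last_map last_yp odd_p lyp; exact: edge.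
(* A path of even length links [0xc -- 1yc] to [1xc], i.e. joins the two copies
   of [xc]; two such paths, for the [G0]-related continuations [r0...] and
   [r1...], are then connected at both ends. *)
have [r [m xr]] := s_dense x.
pose c b : cantor_space := scat (rcons r b) (fun=> false).
pose sheet b := map (vertex (c b)) ((false, x) :: alternate true (y :: p)).
have szsheet : {in (false, x) :: alternate true (y :: p),
    forall u, size u.2 = size y}.
  by move=> u; rewrite inE => /predU1P[->|/szalt].
(* For an even path, parity puts the end [x] on the side [true], so the vertex [(false, x)] is
   new. *)
have usheet b : uniq (sheet b).
  rewrite (uniq_vertex _ szsheet) cons_uniq ualt andbT -lyp.
  by apply/negP => /(alternate_last_parity uyp); rewrite (negbTE even_p).
have psheet b : path symmb (vertex (c b) (false, x)) (behead (sheet b)).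
  by rewrite /= edge path_yp.
have lsheet b : last (vertex (c b) (false, x)) (behead (sheet b)) =
    vertex (c b) (true, x).
  by rewrite /= last_map last_yp (negbTE even_p) lyp.
have link b : symmb (vertex (c b) (true, x)) (vertex (c (~~ b)) (false, x)).
  apply/asboolP/(symm_cross true); rewrite -!scat_cat; apply: adj_cross.
  by exists m, b, [::]; rewrite -!rcons_cat xr !cats1.
apply: (Acyclic_cycle (c := sheet false ++ sheet true) acB).
(* Each sheet has at least two vertices, even when [x = y] and [p] is empty. *)
- by rewrite size_cat /= !addnS.
- rewrite cat_uniq !usheet andbT andTb; apply/hasPn => v /mapP[u us ->].
  apply/mapP => -[u' us' /vertex_inj[]]; first by rewrite !szsheet.
  by move=> _ /scat_inj[]; rewrite ?size_rcons // => /rcons_inj[].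
- rewrite cycle_cat2 !psheet !lsheet; apply/and4P.
  by split=> //; [exact: (link false)|exact: (link true)].
Qed.

End Crossing.

(** * Digitwise description of [s(G0)] and passage to the limit along prefixes *)

Definition separated m n (a b : nat -> bool) :=
  [/\ forall j, j < m -> a j = nth false (s_ m) j /\ b j = nth false (s_ m) j,
      a m != b m & forall j, m < j < n -> a j = b j].

Lemma adj_separated n (a b : nat -> bool) :
  adj (mkseq a n) (mkseq b n) -> exists2 m, m < n & separated m n a b.
Proof.
move=> [m [e [w [aE bE]]]].
have nE : n = m + (size w).+1.
  by rewrite -(size_mkseq a n) aE size_cat size_s_.
have aj j : j < n -> a j = nth false (s_ m ++ e :: w) j.
  by move=> jn; rewrite -aE nth_mkseq.
have bj j : j < n -> b j = nth false (s_ m ++ ~~ e :: w) j.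
  by move=> jn; rewrite -bE nth_mkseq.
have mn : m < n by rewrite nE -addSnnS leq_addr.
exists m => //; split=> [j jm||j /andP[mj jn]].
- by rewrite aj ?bj ?(ltn_trans jm) // !nth_cat size_s_ jm.
- by rewrite aj ?bj // !nth_cat size_s_ ltnn subnn /=; case: (e).
- rewrite aj ?bj // !nth_cat size_s_ ltnNge ltnW //=.
  by case: (j - m) (subn_gt0 m j) => //; rewrite mj.
Qed.

Lemma symm_G0P a b : symm G0 (a, b) <-> exists m, forall n, separated m n a b.
Proof.
split.
  have sep m e c n : separated m n (scat (rcons (s_ m) e) c)
                                   (scat (rcons (s_ m) (~~ e)) c).
    split=> [j jm||j /andP[mj _]]; rewrite !scat_nth !size_rcons size_s_.
    - by rewrite ltnS ltnW // !nth_rcons size_s_ jm.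
    - by rewrite ltnSn !nth_rcons size_s_ ltnn eqxx; case: e.
    - by rewrite ltnNge mj.
  move=> [] [m [c [-> ->]]]; exists m.
    exact: (sep m false).
  exact: (sep m true).
move=> [m sepm]; have [am abm _] := sepm 0.
have ab j : m < j -> a j = b j.
  by move=> mj; have [_ _] := sepm j.+1; apply; rewrite mj ltnSn.
have cutE (d : cantor_space) : (forall j, j < m -> d j = nth false (s_ m) j) ->
    d = scat (rcons (s_ m) (d m)) (fun i => d (m.+1 + i)).
  move=> dj; apply: funext => j; rewrite scat_nth size_rcons size_s_ ltnS.
  case: ltngtP => [jm|mj|->]; last by rewrite nth_rcons size_s_ ltnn eqxx.
    by rewrite nth_rcons size_s_ jm dj.
  by rewrite subnKC.
have tailE : (fun i => b (m.+1 + i)) = (fun i => a (m.+1 + i)).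
  by apply: funext => i; rewrite ab // leq_addr.
rewrite [a]cutE; last by move=> j /am[].
rewrite [b]cutE; last by move=> j /am[].
rewrite tailE.
have bm : b m = ~~ a m by move: abm; case: (a m) (b m) => [] [].
by rewrite bm; case: (a m); [right|left]; exists m, (fun i => a (m.+1 + i)).
Qed.

(** The index of a separation is the first place where [a] and [b] differ, hence the same for all
    prefixes; longer and longer prefixes then give agreement everywhere beyond it. *)
Lemma adj_limit a b :
  (forall N, exists2 n, N <= n & adj (mkseq a n) (mkseq b n)) -> symm G0 (a, b).
Proof.
move=> adj_ab; apply/symm_G0P.
have [k _ /adj_separated[m mk [am abm _]]] := adj_ab 0.
exists m => n; split=> // j /andP[mj jn].
have [l nl /adj_separated[m' m'l [am' abm' ab']]] := adj_ab (maxn k n).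
have m'E : m' = m.
  apply/eqP; rewrite eqn_leq leqNgt [m <= _]leqNgt; apply/andP; split.
    by apply/negP => /am'[ea eb]; move: abm; rewrite ea eb eqxx.
  by apply/negP => /am[ea eb]; move: abm'; rewrite ea eb eqxx.
apply: ab'; rewrite m'E mj (leq_trans jn) //.
by apply: leq_trans nl; rewrite leq_maxr.
Qed.

(** * Recursive choice and finite families of dense requirements *)

Lemma dependent_seq (T : Type) (P : seq T -> T -> Prop) :
  (forall s, exists x, P s x) ->
  exists t : nat -> T, forall n, P (mkseq t n) (t n).
Proof.
move=> /choice[next nextP].
pose prefix n := iter n (fun s => rcons s (next s)) [::].
exists (fun n => next (prefix n)) => n.
suff -> : mkseq (fun n => next (prefix n)) n = prefix n by [].
by elim: n => // n IHn; rewrite mkseqS IHn.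
Qed.

(** The requirements persist under extension, so they are met one after the other, as in a finite
    intersection of dense open sets. *)
Lemma meet_dense (I : eqType) (D : I -> seq bool -> Prop) (l : seq I) :
  (forall i w v, D i w -> D i (w ++ v)) ->
  (forall i w, i \in l -> exists v, D i (w ++ v)) ->
  exists w, forall i, i \in l -> D i w.
Proof.
move=> Dcat; elim: l => [|i l IHl] Dl; first by exists [::].
have [|w wP] := IHl; first by move=> j w jl; apply: Dl; rewrite inE jl orbT.
have [|v vP] := Dl i w; first exact: mem_head.
by exists (w ++ v) => j; rewrite inE => /predU1P[->//|/wP]; apply: Dcat.
Qed.

(** * The map that inserts fixed words between the digits of a point *)

Section Insertion.
Variable t : nat -> seq bool.
Implicit Types a b : cantor_space.

Definition insert a n := flatten (mkseq (fun j => rcons (t j) (a j)) n).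

(** Each digit takes one place whatever its value, so the blocks of all points are aligned and the
    length does not depend on the point. *)
Definition insert_size n := sumn (mkseq (fun j => (size (t j)).+1) n).

(* The position of the digit [a n] in [insert_lim a]. *)
Definition digit n := insert_size n + size (t n).

(** Every block has at least one letter, so [insert a k.+1] has more than [k] letters and the
    default of [nth] is never reached. *)
Definition insert_lim a : cantor_space := fun k => nth false (insert a k.+1) k.

Lemma insertS a n : insert a n.+1 = insert a n ++ rcons (t n) (a n).
Proof. by rewrite /insert mkseqS flatten_rcons. Qed.

Lemma insert_sizeS n : insert_size n.+1 = (digit n).+1.
Proof. by rewrite /insert_size mkseqS sumn_rcons addnS. Qed.

Lemma size_insert a n : size (insert a n) = insert_size n.
Proof.
elim: n => // n IHn.
by rewrite insertS insert_sizeS size_cat size_rcons IHn addnS.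
Qed.

Lemma leq_insert_size n : n <= insert_size n.
Proof.
elim: n => // n IHn; rewrite insert_sizeS ltnS.
exact: leq_trans IHn (leq_addr _ _).
Qed.

Lemma leq_digit n : n <= digit n.
Proof. exact: leq_trans (leq_insert_size n) (leq_addr _ _). Qed.

Lemma ltn_digit : {homo digit : m n / m < n}.
Proof.
apply: homo_ltn; first exact: ltn_trans.
by move=> n; rewrite -insert_sizeS leq_addr.
Qed.

Lemma leq_digit_mono : {mono digit : m n / m <= n}.
Proof. exact: leq_mono ltn_digit. Qed.

Lemma ltn_digit_mono : {mono digit : m n / m < n}.
Proof. exact: leqW_mono leq_digit_mono. Qed.

Lemma insert_prefix a m n : m <= n -> exists v, insert a n = insert a m ++ v.
Proof.
move=> /subnKC <-; elim: (n - m) => [|k [v IHk]].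
  by exists [::]; rewrite addn0 cats0.
by eexists; rewrite addnS insertS IHk -catA.
Qed.

Lemma insert_limE a n k : k < insert_size n ->
  insert_lim a k = nth false (insert a n) k.
Proof.
move=> kn; have kk := leq_insert_size k.+1.
have [/(insert_prefix a)[v vE]|/ltnW/(insert_prefix a)[v vE]] := leqP n k.+1.
  by rewrite /insert_lim vE nth_cat size_insert kn.
by rewrite vE nth_cat size_insert kk.
Qed.

Lemma mkseq_insert_lim a n : mkseq (insert_lim a) (insert_size n) = insert a n.
Proof.
apply: (@eq_from_nth _ false) => [|k]; rewrite size_mkseq ?size_insert // => kn.
by rewrite nth_mkseq // (insert_limE _ kn).
Qed.

Lemma insert_lim_digit a n : insert_lim a (digit n) = a n.
Proof.
rewrite (@insert_limE _ n.+1) ?insert_sizeS // insertS nth_cat size_insert.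
by rewrite ltnNge leq_addr /= addKn nth_rcons ltnn eqxx.
Qed.

Lemma mkseq_insert_digit a n :
  mkseq (insert_lim a) (digit n) = insert a n ++ t n.
Proof.
have := mkseq_insert_lim a n.+1; rewrite insert_sizeS mkseqS insertS.
by rewrite -rcons_cat => /rcons_inj[].
Qed.

(** A place lies either in an inserted word, common to all points, or at [digit n] for a single
    [n]. *)
Lemma insert_lim_agree a b k :
  (forall n, digit n = k -> a n = b n) -> insert_lim a k = insert_lim b k.
Proof.
move=> ab; have [m kS] : exists m, k < insert_size m.
  by exists k.+1; apply: leq_insert_size.
rewrite !(insert_limE _ kS); elim: m kS => // n IHn.
rewrite insert_sizeS !insertS !nth_cat !size_insert.
have [kn _|nk] := ltnP k (insert_size n); first exact: IHn.
rewrite ltnS leq_eqVlt => /predU1P[kE|]; last first.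
  by rewrite -ltn_subLR // !nth_rcons => ->.
by rewrite kE addKn !nth_rcons ltnn eqxx ab.
Qed.

Lemma insert_lim_inj : injective insert_lim.
Proof.
move=> a b ab; apply: funext => n.
by rewrite -[LHS]insert_lim_digit ab insert_lim_digit.
Qed.

(** This makes the insertion respect [G0]: points splitting after [s_n] have images splitting after
    [s_m] with [m = digit n]. Only the first [n] digits of the argument enter, so the default beyond
    [s_n] is harmless. *)
Hypothesis s_digit : forall n,
  mkseq (insert_lim (nth false (s_ n))) (digit n) = s_ (digit n).

Lemma insert_lim_G0 a b :
  symm G0 (insert_lim a, insert_lim b) <-> symm G0 (a, b).
Proof.
have s_digitE n k : k < digit n ->
    nth false (s_ (digit n)) k = insert_lim (nth false (s_ n)) k.
  by move=> kn; rewrite -s_digit nth_mkseq.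
split=> /symm_G0P[m sepm]; apply/symm_G0P; last first.
  exists (digit m) => n; split=> [k km||k /andP[mk _]].
  - have [am _ _] := sepm 0.
    by rewrite s_digitE //; split; apply: insert_lim_agree => i ik;
      move: km; rewrite -ik ltn_digit_mono => /am[].
  - by rewrite !insert_lim_digit; case: (sepm 0).
  - apply: insert_lim_agree => i ik; move: mk; rewrite -ik ltn_digit_mono => mi.
    by have [_ _] := sepm i.+1; apply; rewrite mi /=.
have [am abm _] := sepm 0.
(* Outside the digit places the two images agree, so they can only split at a digit place. *)
have [j jm] : exists j, digit j = m.
  apply: contrapT => /forallNP nj; case/eqP: abm.
  by apply: insert_lim_agree => n /nj.
exists j => n; rewrite -jm in am abm sepm; split=> [i ij||i /andP[ji _]].
- move: ij; rewrite -ltn_digit_mono => ij; have [] := am _ ij.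
  by rewrite s_digitE // !insert_lim_digit.
- by move: abm; rewrite !insert_lim_digit.
- rewrite -[a i]insert_lim_digit -[b i]insert_lim_digit.
  by have [_ _] := sepm (digit i).+1; apply; rewrite ltn_digit_mono ji /=.
Qed.

End Insertion.

Lemma eq_insert t u a b n : (forall j, j < n -> t j = u j) ->
  (forall j, j < n -> a j = b j) -> insert t a n = insert u b n.
Proof.
move=> tu ab; congr flatten; apply/eq_in_map => j; rewrite mem_iota => jn.
by rewrite tu ?ab.
Qed.

(** * Generic choice of the inserted words *)

Section Generic.
Variables (B : set (cantor_space * cantor_space))
  (F : nat -> set (cantor_space * cantor_space)).
Hypothesis B_swap : forall e a b,
  B (scons e a, scons (~~ e) b) <-> B (scons e b, scons (~~ e) a).
Hypothesis B0B : B0 `<=` B.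
Hypothesis acB : Acyclic B.
Hypothesis clF : forall i, closed (F i).
Hypothesis FB : B = \bigcup_i F i.

(** The continuations are independent, so whole cylinders are kept from being joined through [F i];
    this open condition persists under extension. *)
Definition avoids i x y := forall c d, ~ cross (F i) (scat x c) (scat y d).

Lemma avoids_cat i x y w : avoids i x y -> avoids i (x ++ w) (y ++ w).
Proof. by move=> xy c d; rewrite !scat_cat; apply: xy. Qed.

(** Some common continuation is not crossed through [B], hence not through the closed set [F i] in
    either direction; a long enough prefix of it secures a neighbourhood. *)
Lemma nonadj_avoids i x y : size x = size y -> ~ adj x y ->
  exists v, avoids i (x ++ v) (y ++ v).
Proof.
move=> xy /(nonadj_not_cross B_swap B0B acB xy)[c Bxy].
have sub u v : F i (u, v) -> B (u, v) by rewrite FB; exists i.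
have opF : open (~` F i) by exact: closed_openC.
have [m mP] : exists m, forall u v,
    cylinder (scons false (scat x c)) m u ->
    cylinder (scons true (scat y c)) m v ->
    ~ F i (u, v).
  by apply: open_cylinders opF _ => /sub xyB; apply: Bxy; left.
have [n nP] : exists n, forall u v,
    cylinder (scons true (scat y c)) n u ->
    cylinder (scons false (scat x c)) n v ->
    ~ F i (u, v).
  by apply: open_cylinders opF _ => /sub xyB; apply: Bxy; right.
pose k := maxn m n.
have cyl e z d l : l <= k ->
    cylinder (scons e (scat z c)) l (scons e (scat (z ++ mkseq c k) d)).
  move=> lk [_|j jl]; first by [].
  rewrite !sconsS scat_cat !scat_nth; case: ltnP => // zj.
  have jk : j - size z < k.
    by apply: leq_ltn_trans (leq_subr _ _) _; apply: leq_trans lk; apply: ltnW.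
  by rewrite size_mkseq jk nth_mkseq.
exists (mkseq c k) => d d' []; [apply: mP|apply: nP];
  by apply: cyl; rewrite ?leq_maxl ?leq_maxr.
Qed.

(** There are finitely many triples to treat. Non-adjacency survives a common extension by
    [adj_catK], so each requirement is still dense after the earlier ones are met. *)
Lemma avoids_words n l : exists w, forall i x y, i <= n -> size x = l ->
  size y = l -> ~ adj x y -> avoids i (x ++ w) (y ++ w).
Proof.
pose D (q : nat * (seq bool * seq bool)) w :=
  ~ adj q.2.1 q.2.2 -> avoids q.1 (q.2.1 ++ w) (q.2.2 ++ w).
pose wl := binwords l.
have [||w wP] := @meet_dense _ D
    [seq (i, p) | i <- iota 0 n.+1, p <- [seq (x, y) | x <- wl, y <- wl]].
- by move=> q w v Dw nadj; rewrite !catA; apply/avoids_cat/Dw.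
- move=> _ w /allpairsP[[i _] /= [_ /allpairsP[[x y] /= [xl yl ->]] ->]].
  move: xl yl; rewrite !mem_binwords => /eqP xl /eqP yl.
  have [nadj|adjxy] := pselect (~ adj x y); last by exists [::].
  have [||v vP] := @nonadj_avoids i (x ++ w) (y ++ w).
  + by rewrite !size_cat xl yl.
  + by move=> /adj_catK /nadj; apply; rewrite xl yl.
  by exists v => _; rewrite /= !catA.
exists w => i x y ilen xl yl; apply: (wP (i, (x, y))).
apply/allpairsP; exists (i, (x, y)); split=> //; first by rewrite mem_iota.
by apply/allpairsP; exists (x, y); rewrite !mem_binwords xl yl.
Qed.

(** The word chosen at stage [n] first secures avoidance for all non-adjacent words of the current
    length and all [i <= n]. It is then prolonged until the image of [s_n] is some [s_m], which
    preserves avoidance. *)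
Lemma generic_insertion : exists t : nat -> seq bool,
  [/\ forall n,
        mkseq (insert_lim t (nth false (s_ n))) (digit t n) = s_ (digit t n)
    & forall n i a b, i <= n -> ~ adj (insert t a n) (insert t b n) ->
        ~ cross (F i) (insert_lim t a) (insert_lim t b)].
Proof.
pose P (ts : seq (seq bool)) w := let n := size ts in let t := nth [::] ts in
  (exists m, insert t (nth false (s_ n)) n ++ w = s_ m) /\
  (forall i x y, i <= n -> size x = insert_size t n ->
     size y = insert_size t n -> ~ adj x y -> avoids i (x ++ w) (y ++ w)).
have [ts|t tP] := @dependent_seq _ P.
  set n := size ts; set t := nth [::] ts.
  have [w wP] := avoids_words n (insert_size t n).
  have [r [m rm]] := s_dense (insert t (nth false (s_ n)) n ++ w).
  exists (w ++ r); split; first by exists m; rewrite catA.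
  by move=> *; rewrite !catA; apply/avoids_cat/wP.
have insE a n : insert (nth [::] (mkseq t n)) a n = insert t a n.
  by apply: eq_insert => // j jn; rewrite nth_mkseq.
exists t; split=> n.
  have [+ _] := tP n; rewrite size_mkseq insE => -[m mE].
  (* As [s_ m] has length [m], comparing lengths identifies the index with [digit t n]. *)
  rewrite mkseq_insert_digit mE; congr s_.
  by rewrite -(size_s_ m) -mE size_cat size_insert.
move=> i a b ilen nadj; have [_] := tP n; rewrite size_mkseq => avoid.
have sizeE : insert_size (nth [::] (mkseq t n)) n = insert_size t n.
  by rewrite -(size_insert _ point) insE size_insert.
rewrite (scat_take (insert_lim t a) (digit t n)).
rewrite (scat_take (insert_lim t b) (digit t n)) !mkseq_insert_digit.
by apply: avoid; rewrite // ?sizeE ?size_insert.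
Qed.

End Generic.

Theorem theorem7p9 (B : set (cantor_space * cantor_space))
  (B_bip : B `<=` (N_ [:: false] `*` N_ [:: true])
                  `|` (N_ [:: true] `*` N_ [:: false]))
  (B_Fsigma : Fsigma B)
  (B_acyclic : Acyclic B)
  (B_oriented : oriented_graph B)
  (B_B0 : B0 = closure B0 `&` B)
  (B_swap : forall (e : bool) (a b : cantor_space),
      B (scons e a, scons (~~ e) b) <-> B (scons e b, scons (~~ e) a)) :
  cont_reduces G_sG0 B.
Proof.
have B0B : B0 `<=` B by rewrite B_B0; apply: subIsetr.
have [F clF FB] := B_Fsigma.
have [t [s_digit generic]] := generic_insertion B_swap B0B B_acyclic clF FB.
pose h := insert_lim t.
have hG0 a b : symm G0 (h a, h b) <-> symm G0 (a, b) by apply: insert_lim_G0.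
have G0_B a b : symm G0 (h a, h b) -> B (scons false (h a), scons true (h b)).
  case=> [/(G0_cross B0B)//|/(G0_cross B0B) Bba].
  exact/(B_swap false).
have cross_G0 a b : cross B (h a) (h b) -> symm G0 (h a, h b).
  move=> Bab; have [i Fi] : exists i, cross (F i) (h a) (h b).
    by move: Bab; rewrite /cross FB => -[[i _ ?]|[i _ ?]]; exists i; [left|right].
  (* Stage [maxn i N] is late enough both to have treated [F i] and to reach length [N];
     non-adjacent prefixes there would contradict [Fi]. *)
  apply: adj_limit => N; exists (insert_size t (maxn i N)).
    by apply: leq_trans (leq_insert_size t _); apply: leq_maxr.
  apply: contrapT; rewrite !mkseq_insert_lim => /generic.
  by apply; [exact: leq_maxl|exact: Fi].
pose f (a : cantor_space) : cantor_space := scons (a 0) (h (fun i => a i.+1)).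
have fE e a : f (scons e a) = scons e (h a).
  by rewrite /f; congr (scons _ (h _)); apply: funext => i; rewrite sconsS.
exists f; split.
- move=> a b /scons_inj[ab0 /insert_lim_inj abS].
  by rewrite (scons_eta a) (scons_eta b) ab0 abS.
- apply: continuous_cantor => a [|k]; first by exists 1 => b; apply.
  (* Place [k.+1] of the image depends at most on the tail digit [n] with [digit n = k]. Then
     [n <= k], and this digit is coordinate [n.+1 < k.+2] of the argument. *)
  exists k.+2 => b ab; rewrite /f !sconsS.
  by apply: insert_lim_agree => n nk; apply: ab; rewrite !ltnS -nk leq_digit.
move=> x y; rewrite (scons_eta x) (scons_eta y) !fE.
move: (x 0) (y 0) (fun i => x i.+1) (fun i => y i.+1) => d e a b.
split=> [Bab|]; last first.
  move=> [[a' b'] ab' /= [/scons_inj[<- <-] /scons_inj[<- <-]]].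
  exact/G0_B/hG0.
have := B_bip _ Bab.
case: d e Bab => [] [] Bab [] [/(_ 0 isT) //= _ /(_ 0 isT) //= _].
(* An edge from [N_1] to [N_0] makes [h b] and [h a] related in [s(G0)], which puts the reverse edge
   in [B] too. Orientation then forces equal endpoints, though their first digits differ. *)
- have Bba : B (scons false (h b), scons true (h a)).
    by apply: G0_B; apply: cross_G0; right.
  by have [_ /(_ _ (conj Bab Bba)) /scons_inj[]] := B_oriented.
- by exists (a, b) => //; apply/hG0/cross_G0; left.
Qed.
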